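(* In the known-preferences setting, for any $\delta>0$ there is no deterministic strategyproof mechanism with approximation ratio better (smaller) than $2-\delta$.
   Context: Setting: a finite nonempty set $N$ of $n$ agents and two facilities $1,2$. Agent $i$ has a position $x_i\in[0,1]$ and an approval preference $t_i=(t_{i1},t_{i2})\in\{0,1\}^2$ ($t_{ij}=1$ iff $i$ approves facility $j$); every agent approves at least one facility. An instance is $I=(\mathbf{x},\mathbf{t})$. If facility $j$ is located at $y\in[0,1]$ (a single facility is located), agent $i$ has utility $u_i(j,y|I)=t_{ij}(1-|x_i-y|)$; the social welfare is $W(j,y|I)=\sum_{i\in N}u_i(j,y|I)$ and $W^*(I)=\max_{(j,y)}W(j,y|I)$. A deterministic mechanism $M$ maps each instance $I$ to an outcome $M(I)=(j,y)\in\{1,2\}\times[0,1]$. Its approximation ratio is $\rho(M)=\sup_I W^*(I)/W(M(I)|I)$ over all instances (with any number of agents). In the known-preferences setting preferences are public and agents can misreport only positions: $M$ is strategyproof if for every instance $I=(\mathbf{x},\mathbf{t})$, agent $i$ and $x_i'\in[0,1]$, with $I'=((x_i',\mathbf{x}_{-i}),\mathbf{t})$, we have $u_i(M(I)|I)\ge u_i(M(I')|I)$. *)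

(* Defs.v *)
From mathcomp Require Import all_boot all_order all_algebra.
From mathcomp Require Import all_classical all_reals all_analysis.
From mathcomp Require Import lra.

Set Implicit Arguments.
Unset Strict Implicit.
Unset Printing Implicit Defensive.

Import Order.TTheory GRing.Theory Num.Theory.
Import numFieldNormedType.Exports.

Local Open Scope classical_set_scope.
Local Open Scope ring_scope.

(* The two facilities are the elements of 'I_2; positions and locations range
   over the unit interval, i.e. the library type {i01 R}. *)
Record instance (R : realType) (n : nat) : Type := Instance {
  position : {ffun 'I_n -> {i01 R}} ;
  approves : {ffun 'I_n -> {ffun 'I_2 -> bool}} ;
  approves_some : [forall i, exists j, approves i j]
}.

(* (j, y): the single facility j is located at y. *)
Definition outcome (R : realType) : Type := ('I_2 * {i01 R})%type.

Section Welfare.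
Context (R : realType) (n : nat).
Implicit Types (I : instance R n) (o : outcome R).

Definition utility I (i : 'I_n) o : R :=
  (approves I i o.1)%:R * (1 - `|(position I i)%:num - o.2%:num|).

Definition welfare I o : R := \sum_i utility I i o.

Definition opt_welfare I : R := sup (range (welfare I)).

Definition misreport I (i : 'I_n) (x' : {i01 R}) : instance R n :=
  @Instance R n [ffun k => if k == i then x' else position I k]
    (approves I) (approves_some I).

End Welfare.

(* n.+1 because the set of agents is nonempty. *)
Definition mechanism (R : realType) : Type :=
  forall n : nat, instance R n.+1 -> outcome R.

Definition strategyproof (R : realType) (M : mechanism R) : Prop :=
  forall (n : nat) (I : instance R n.+1) (i : 'I_n.+1) (x' : {i01 R}),
    utility I i (M n (misreport I i x')) <= utility I i (M n I).

(* The quotient is taken in \bar R, where r%:E / 0 = +oo for r > 0; the optimal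
   welfare is always positive. *)
Definition approx_ratio (R : realType) (M : mechanism R) : \bar R :=
  ereal_sup [set r : \bar R | exists (n : nat) (I : instance R n.+1),
    r = ((opt_welfare I)%:E / (welfare I (M n I))%:E)%E].

(* The supremum defining [opt_welfare] is a maximum. *)
Lemma opt_welfare_max (R : realType) (n : nat) (I : instance R n) :
  exists o : outcome R, opt_welfare I = welfare I o /\
    forall o' : outcome R, welfare I o' <= welfare I o.
Proof.
have loc j : exists y : {i01 R}, forall y', welfare I (j, y') <= welfare I (j, y).
  pose f (y : R) : R :=
    \sum_i (approves I i j)%:R * (1 - `|(position I i)%:num - y|).
  have cf : continuous f.
    apply: continuous_big => [|i _]; first exact: add_continuous.
    move=> y; apply: cvgM; first exact: cvg_cst.
    apply: cvgB; first exact: cvg_cst.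
    by apply: cvg_norm; apply: cvgB; [exact: cvg_cst | exact: cvg_id].
  have [c + cmax] := EVT_max (@ler01 R) (continuous_subspaceT cf).
  rewrite in_itv/= => /andP[c0 c1].
  exists (Itv01 c0 c1) => y'; apply: (cmax y'%:num).
  by rewrite in_itv/= ge0 le1.
have [y0 my0] := loc ord0; have [y1 my1] := loc ord_max.
suff: exists o : outcome R, forall o', welfare I o' <= welfare I o.
  move=> [a amax]; exists a; split => //; apply/eqP; rewrite eq_le; apply/andP; split.
    by apply: ge_sup => [|_ [b _ <-]//]; exists (welfare I a), a.
  by apply: ub_le_sup; [exists (welfare I a) => _ [b _ <-] | exists a].
have two (j : 'I_2) : j = ord0 \/ j = ord_max.
  by case: j => [[|[|//]] ?]; [left | right]; exact: val_inj.
have [le01|/ltW le10] := leP (welfare I (ord0, y0)) (welfare I (ord_max, y1)).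
  by exists (ord_max, y1) => -[j y]; case: (two j) => ->;
    rewrite ?(le_trans (my0 y)).
by exists (ord0, y0) => -[j y]; case: (two j) => ->;
  rewrite ?(le_trans (my1 y)).
Qed.

Lemma opt_welfare_gt0 (R : realType) (n : nat) (I : instance R n.+1) :
  0 < opt_welfare I.
Proof.
have [a [-> amax]] := opt_welfare_max I.
have /forallP/(_ ord0)/existsP[j aj] := approves_some I.
apply: lt_le_trans (amax (j, position I ord0)).
rewrite /welfare big_ord_recl ltr_pwDl//.
  by rewrite /utility/= aj subrr normr0 subr0 mulr1.
apply: sumr_ge0 => i _; rewrite mulr_ge0// subr_ge0 ler_norml/=.
have p01 k : 0 <= (position I k)%:num <= 1 by rewrite ge0 le1.
move: (p01 ord0) (p01 (lift ord0 i)) => /andP[? ?] /andP[? ?].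
by apply/andP; split; lra.
Qed.

(* Main.v *)
(** Take two agents approving only facility 1 and two approving only facility 2,
    each pair placed at [e] and [1 - e].  By strategyproofness, the agents not
    served by the chosen facility cannot make the mechanism switch: at an
    interior position, every location of their own facility is worth something
    to them.  So let the unserved agent at [1 - e] join its partner at [e]: the
    choice of facility is unchanged and yields welfare at most [1 + 2 * e],
    whereas the other facility located at [e] yields 2. *)
Require Import Defs.
From mathcomp Require Import all_boot all_order all_algebra.
From mathcomp Require Import all_classical all_reals all_analysis.
From mathcomp Require Import lra.

Import Order.TTheory GRing.Theory Num.Theory.

Local Open Scope ring_scope.

Lemma utility_gt0 (R : realType) (n : nat) (I : instance R n) (i : 'I_n)
    (o : outcome R) :
  approves I i o.1 -> 0 < (position I i)%:num < 1 -> 0 < utility I i o.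
Proof.
move=> io /andP[x_gt0 x_lt1]; rewrite /utility io mul1r subr_gt0 ltr_norml.
have y_ge0 : 0 <= o.2%:num by [].
have y_le1 : o.2%:num <= 1 by rewrite le1.
by apply/andP; split; lra.
Qed.

(** An unserved agent has utility 0, while being served after the misreport would be worth something
    positive at its true, interior position. *)
Lemma strategyproof_unserved (R : realType) (M : mechanism R) (n : nat)
    (I : instance R n.+1) (i : 'I_n.+1) (x' : {i01 R}) :
  strategyproof M -> 0 < (position I i)%:num < 1 ->
  ~~ approves I i (M n I).1 -> ~~ approves I i (M n (misreport I i x')).1.
Proof.
move=> spM x01 /negbTE unserved; apply/negP => served.
have := lt_le_trans (utility_gt0 R n.+1 I i _ served x01) (spM n I i x').
by rewrite {1}/utility unserved mul0r ltxx.
Qed.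

Lemma welfare_lt_approx_ratio (R : realType) (M : mechanism R) (r : R) (n : nat)
    (I : instance R n.+1) (o : outcome R) :
  (approx_ratio M < r%:E)%E -> 0 < welfare I (M n I) ->
  welfare I o < r * welfare I (M n I).
Proof.
move=> Mr W_gt0; have [a [optE /(_ o) leo]] := opt_welfare_max I.
rewrite (le_lt_trans leo)// -optE -ltr_pdivrMr// -lte_fin.
apply: le_lt_trans Mr; apply: ereal_sup_ubound.
by exists n, I; rewrite inver gt_eqF.
Qed.

Lemma two_pairs_approves_some :
  [forall i, exists j, [ffun i : 'I_4 => [ffun j : 'I_2 => i./2 == j]] i j].
Proof.
apply/forallP => i; apply/existsP.
have lt_i2 : (i./2 < 2)%N by rewrite ltn_half_double ltn_ord.
by exists (Ordinal lt_i2); rewrite !ffunE.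
Qed.

Definition two_pairs (R : realType) (a b : {i01 R}) : instance R 4 :=
  @Instance R 4 [ffun i : 'I_4 => if odd i then b else a] _
    two_pairs_approves_some.

Theorem theorem4p1 (R : realType) (delta : R) (delta_gt0 : 0 < delta) :
  ~ exists M : mechanism R,
      strategyproof M /\ (approx_ratio M < (2 - delta)%:E)%E.
Proof.
move=> [M [spM Mratio]].
(* The bound [delta / 4] absorbs the error [4 * e] of the final estimate; [1 / 4] keeps [e] and
   [1 - e] interior. *)
pose e : R := Num.min (delta / 4) (1 / 4).
have e_gt0 : 0 < e by rewrite lt_min; apply/andP; split; lra.
have e_led : e <= delta / 4 by rewrite ge_min lexx.
have e_le : e <= 1 / 4 by rewrite ge_min lexx orbT.
have a0 : 0 <= e by lra.
have a1 : e <= 1 by lra.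
have b0 : 0 <= 1 - e by lra.
have b1 : 1 - e <= 1 by lra.
pose a := Itv01 a0 a1; pose b := Itv01 b0 b1.
pose I := two_pairs R a b.
have interior i : 0 < (position I i)%:num < 1.
  by rewrite ffunE; case: ifP => _ /=; apply/andP; split; lra.
(* [k] is the facility not chosen on [I]; odd indices sit at [b], so [i] is the agent of pair [k]
   that will move. *)
have [k [i [ik unserved]]] : exists (k : 'I_2) (i : 'I_4),
    i = k.*2.+1 :> nat /\ ~~ approves I i (M 3 I).1.
  case: (M 3 I).1 => [[|[|//]] j_lt2].
    by exists (Ordinal (isT : 1 < 2)%N), (Ordinal (isT : 3 < 4)%N); rewrite !ffunE.
  by exists (Ordinal (isT : 0 < 2)%N), (Ordinal (isT : 1 < 4)%N); rewrite !ffunE.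
pose I' := misreport I i a.
have other : (M 3 I').1 != k.
  have := strategyproof_unserved R M 3 I i a spM (interior i) unserved.
  by rewrite !ffunE ik /= uphalf_double eq_sym.
have W_other : welfare I' (k, a) = 2.
  rewrite /welfare !big_ord_recl big_ord0 /utility !ffunE -!val_eqE /= ik.
  case: (k) => [[|[|//]] k_lt2] /=;
  by rewrite subrr normr0; lra.
(* The chosen facility's pair has not moved: the distances of [y] to [e] and [1 - e] sum to at least
   [1 - 2 * e] and at most 1. *)
have W_chosen : 1 <= welfare I' (M 3 I') <= 1 + 2 * e.
  case: (M 3 I') other => j y /= jk.
  have y_ge0 : 0 <= y%:num by [].
  have y_le1 : y%:num <= 1 by rewrite le1.
  have : 1 <= (1 - `|e - y%:num|) + (1 - `|1 - e - y%:num|) <= 1 + 2 * e.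
    by case: ger0P => ?; case: ger0P => ?; apply/andP; split; lra.
  rewrite /welfare !big_ord_recl big_ord0 /utility !ffunE -!val_eqE /= ik.
  case: k j jk {ik W_other unserved} => [[|[|//]] k_lt2] [[|[|//]] j_lt2] //= _;
  by rewrite !mul1r !mul0r !(addr0, add0r).
move: W_chosen => /andP[W_ge1 W_le].
have W_gt0 : 0 < welfare I' (M 3 I') by lra.
have := welfare_lt_approx_ratio R M _ 3 I' (k, a) Mratio W_gt0.
(* With [W] the welfare achieved on [I'], [W >= 1] gives [(2 - delta) * W <= 2 * (1 + 2 * e) - delta
   <= 2], against the strict bound. *)
rewrite W_other; have : delta <= delta * welfare I' (M 3 I') by rewrite ler_peMr// ltW.
lra.
Qed.
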